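(* Let $\varphi\in[0,\pi/2]$, let $I\subseteq\mathbb{R}$ be an open set which is $\varphi$-invex with respect to $\eta:I\times I\to\mathbb{R}$, and let $a,b\in I$ with $\eta(b,a)>0$. Let $f:I\to\mathbb{R}$ be differentiable with $f'\in L_1[a,a+e^{i\varphi}\eta(b,a)]$, and let $\alpha>0$. Suppose $|f'|$ is $h_\varphi$-preinvex on $I$ (with respect to $\varphi$ and $\eta$). Put $c=e^{i\varphi}\eta(b,a)$. Then $$\left|f(a)+f(a+c)-\frac{\Gamma(\alpha+1)}{c^{\alpha}}\left[J_{a^+}^{\alpha}f(a+c)+J_{(a+c)^-}^{\alpha}f(a)\right]\right|\le c\,\bigl[|f'(a)|+|f'(b)|\bigr]\int_0^1\left|(1-t)^{\alpha}-t^{\alpha}\right|h(t)\,dt .$$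
   Context: A set $I\subseteq\mathbb{R}$ is $\varphi$-invex with respect to $\eta:I\times I\to\mathbb{R}$ if $u+te^{i\varphi}\eta(v,u)\in I$ for all $u,v\in I$, $t\in[0,1]$; here $\varphi\in[0,\pi/2]$ is fixed. In particular, since $I\subseteq\mathbb{R}$, the number $e^{i\varphi}\eta(b,a)$ is real. Let $h:J\to\mathbb{R}$ be a nonnegative function, $[0,1]\subseteq J\subseteq\mathbb{R}$, for which the integral on the right-hand side exists as a finite Lebesgue integral. A function $g:I\to\mathbb{R}$ is $h_\varphi$-preinvex (with respect to $\varphi,\eta$) if $g(u+te^{i\varphi}\eta(v,u))\le h(1-t)g(u)+h(t)g(v)$ for all $u,v\in I$, $t\in[0,1]$. Riemann–Liouville fractional integrals of order $\alpha>0$: $J_{p^+}^{\alpha}f(x)=\frac{1}{\Gamma(\alpha)}\int_p^x(x-t)^{\alpha-1}f(t)\,dt$ for $x>p$, and $J_{r^-}^{\alpha}f(x)=\frac{1}{\Gamma(\alpha)}\int_x^r(t-x)^{\alpha-1}f(t)\,dt$ for $x<r$. *)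

(* Defs.v *)
From mathcomp Require Import all_boot all_order all_algebra.
From mathcomp Require Import complex.
From mathcomp Require Import all_classical all_reals all_analysis.

Set Implicit Arguments.
Unset Strict Implicit.
Unset Printing Implicit Defensive.

Import Order.TTheory GRing.Theory Num.Theory.
Import numFieldNormedType.Exports.

Local Open Scope classical_set_scope.
Local Open Scope ring_scope.
Local Open Scope complex_scope.

(* MathComp-Analysis's [lebesgue_measure] lives on the Borel sigma-algebra; the
   completed measure is used throughout, so that "measurable" and "integrable"
   mean Lebesgue measurable and Lebesgue integrable. *)
Notation leb R := (@completed_lebesgue_measure R).

Definition expi {R : realType} (phi : R) : R[i] := cos phi +i* sin phi.

(* The point u + t e^{i phi} eta(v, u), a priori a complex number.  Here and
   below, a function on a set of reals is a total function whose values outside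
   of that set are irrelevant. *)
Definition phi_point {R : realType} (phi : R) (eta : R -> R -> R) (u v t : R)
  : R[i] := u%:C + t%:C * expi phi * (eta v u)%:C.

(* Membership in I of a complex number is membership in the image of I under
   the embedding of the reals: the point must be real and lie in I. *)
Definition phi_invex {R : realType} (phi : R) (eta : R -> R -> R) (I : set R)
  : Prop :=
  forall u v t : R, I u -> I v -> 0 <= t <= 1 ->
    ((fun x : R => x%:C) @` I) (phi_point phi eta u v t).

Definition h_phi_preinvex {R : realType} (h : R -> R) (phi : R)
    (eta : R -> R -> R) (I : set R) (g : R -> R) : Prop :=
  forall u v t w : R, I u -> I v -> 0 <= t <= 1 ->
    I w -> w%:C = phi_point phi eta u v t ->
    g w <= h (1 - t) * g u + h t * g v.

Definition Gamma {R : realType} (s : R) : R :=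
  \int[leb R]_(t in `]0%R, +oo[) (t `^ (s - 1) * expR (- t)).

Definition RL_left {R : realType} (alpha p : R) (f : R -> R) (x : R) : R :=
  (Gamma alpha)^-1 *
  \int[leb R]_(t in `]p, x[) ((x - t) `^ (alpha - 1) * f t).

Definition RL_right {R : realType} (alpha r : R) (f : R -> R) (x : R) : R :=
  (Gamma alpha)^-1 *
  \int[leb R]_(t in `]x, r[) ((t - x) `^ (alpha - 1) * f t).

(* Main.v *)
Require Import Defs.
From mathcomp Require Import all_boot all_order all_algebra.
From mathcomp Require Import complex.
From mathcomp Require Import all_classical all_reals all_analysis.
From mathcomp Require Import measurable_realfun.
From mathcomp Require Import ring lra.

(* The reality of c = e^{i phi} eta(b, a) forces sin phi = 0, so c > 0 and the
   points a + t c, 0 <= t <= 1, lie in I.  With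
   W(x) = ((x - a)^alpha - (a + c - x)^alpha) / c^alpha, the function
   G(x) = W(x) f(x) - \int_a^x W' f is continuous on [a, a + c], satisfies
   G' = W f' on the open segment, and G(a + c) - G(a) is the left-hand side.
   Preinvexity gives |G'(a + t c)| <= A k(1 - t) + B k(t) with A = |f'(a)|,
   B = |f'(b)| and k(t) = |(1 - t)^alpha - t^alpha| h(t).  Since k is merely
   integrable, the increment of G is bounded by a Vitali-Caratheodory argument:
   k is dominated by a sum of multiples of indicators of open sets whose
   integral exceeds that of k by at most e.  The indefinite integral V of this
   sum grows near each x at least as fast as k(x), hence the increments of G are
   locally, and so globally, dominated by those of
   x |-> c (B V((x - a)/c) - A V((a + c - x)/c)) + e x. *)

Set Implicit Arguments.
Unset Strict Implicit.
Unset Printing Implicit Defensive.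

Import Order.TTheory GRing.Theory Num.Theory.
Import numFieldNormedType.Exports.

Local Open Scope classical_set_scope.
Local Open Scope ring_scope.

(** * Increments dominated by a monotone function *)

(* At the supremum of the x in [p, q] with |G x - G p| <= Phi x - Phi p, the local
   hypothesis gives this bound again and, if the supremum is not q, also at points
   beyond it. *)
Lemma le_increment_oo (R : realType) (G Phi : R -> R) (a b p q : R) :
  {homo Phi : x y / x <= y} ->
  (forall x, a < x < b ->
    \forall y \near x, `|G y - G x| <= `|Phi y - Phi x|) ->
  a < p -> p <= q -> q < b -> `|G q - G p| <= Phi q - Phi p.
Proof.
move=> ndPhi loc ap pq qb.
pose S := [set x | p <= x <= q /\ `|G x - G p| <= Phi x - Phi p].
have Sp : S p by rewrite /S/= !subrr normr0 lexx pq.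
have ubS : ubound S q by move=> x [/andP[]].
have hsS : has_sup S by split; [exists p|exists q].
pose s := sup S.
have ps : p <= s by exact: ub_le_sup (ex_intro _ q ubS) _ Sp.
have sq : s <= q by apply: ge_sup => //; exists p.
have extend x y : S x -> x <= y <= q -> `|G y - G x| <= Phi y - Phi x -> S y.
  move=> [/andP[px xq] Gx] /andP[xy yq] Gy; split; first by rewrite yq (le_trans px).
  rewrite (le_trans (ler_distD (G x) _ _))//.
  by rewrite (le_trans (lerD Gy Gx)) // subrKA.
have [] := loc s.
  by rewrite (lt_le_trans ap ps) (le_lt_trans sq qb).
move=> d /= d0 locs.
have Ss : S s.
  have [x Sx sx] := sup_adherent d0 hsS.
  have xs : x <= s by exact: ub_le_sup (ex_intro _ q ubS) _ Sx.
  apply: (extend x) => //; first by rewrite xs.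
  have : `|G x - G s| <= `|Phi x - Phi s|.
    by apply: locs; rewrite /ball_/= ger0_norm ?subr_ge0// ltrBlDr -ltrBlDl.
  by rewrite distrC (distrC (Phi x)) (ger0_norm (_ : 0 <= Phi s - _)) ?subr_ge0 ?ndPhi.
have [<-|sneq] := eqVneq s q; first by case: Ss.
have {sneq} slt : s < q by rewrite lt_neqAle sneq.
(* Half of [d] keeps [y] in the ball where the local bound at [s] holds; the minimum keeps it at
   most [q]. *)
pose y := Num.min q (s + d / 2).
have sy : s < y by rewrite lt_min slt/= ltrDl divr_gt0.
have yS : S y.
  apply: (extend s) => //; first by rewrite (ltW sy) ge_min lexx.
  rewrite -(ger0_norm (_ : 0 <= Phi y - _)) ?subr_ge0 ?ndPhi ?(ltW sy)//.
  apply: locs; rewrite /ball_/= distrC ger0_norm ?subr_ge0 ?(ltW sy)//.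
  rewrite ltrBlDl gt_min; apply/orP; right; lra.
have : y <= s by exact: ub_le_sup (ex_intro _ q ubS) _ yS.
by rewrite leNgt sy.
Qed.

(** The local hypothesis is silent at [a] and [b], so the bound is taken on a smaller segment from
    [p] to [q]. By continuity of [G] the two missing pieces cost less than [e / 2] each, and
    monotonicity of [Phi] bounds [Phi q - Phi p] by [Phi b - Phi a]. *)
Lemma le_increment (R : realType) (G Phi : R -> R) (a b : R) : a < b ->
  {within `[a, b], continuous G} ->
  {homo Phi : x y / x <= y} ->
  (forall x, a < x < b ->
    \forall y \near x, `|G y - G x| <= `|Phi y - Phi x|) ->
  `|G b - G a| <= Phi b - Phi a.
Proof.
move=> ab /(continuous_within_itvP _ ab)[_ Ga Gb] ndPhi loc.
apply/ler_addgt0Pr => e e0.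
have e20 : 0 < e / 2 by rewrite divr_gt0.
have [p [ap pb Gp]] : exists p, [/\ a < p, p < (a + b) / 2 & `|G a - G p| < e / 2].
  near a^'+ => p; exists p; split => //.
  - near: p; apply: nbhs_right_lt; lra.
  - by near: p; move/cvgrPdist_lt : Ga; apply.
have [q [qb aq Gq]] : exists q, [/\ q < b, (a + b) / 2 < q & `|G b - G q| < e / 2].
  near b^'- => q; exists q; split => //.
  - near: q; apply: nbhs_left_gt; lra.
  - by near: q; move/cvgrPdist_lt : Gb; apply.
have pq : p <= q by lra.
have := le_increment_oo ndPhi loc ap pq qb.
have := ndPhi _ _ (ltW ap); have := ndPhi _ _ (ltW qb) => *.
have -> : G b - G a = (G b - G q) + (G q - G p) - (G a - G p) by ring.
rewrite (le_trans (ler_normB _ _))// (le_trans (lerD (ler_normD _ _) (lexx _)))//.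
lra.
Unshelve. all: by end_near. Qed.

(** * Monotone majorants of Lebesgue integrable functions *)

Notation lebT R := (caratheodory_type (wlength (@idfun R))^*%mu).

(** Borel sets are Caratheodory measurable, so the identity pushes the completed measure forward to
    the Borel one; this is how integrals against the two are compared. *)
Lemma measurable_fun_id_completed (R : realType) :
  measurable_fun [set: lebT R] (idfun : lebT R -> measurableTypeR R).
Proof. by move=> _ A mA; rewrite setTI; exact: sub_caratheodory. Qed.

Lemma ge0_integral_completed (R : realType) (D : set R) (f : R -> \bar R) :
  measurable D -> measurable_fun D f -> (forall x, D x -> (0 <= f x)%E) ->
  (\int[leb R]_(x in D) f x = \int[@lebesgue_measure R]_(x in D) f x)%E.
Proof.
move=> mD mf f0.
have /= := @ge0_integral_pushforward _ _ _ _ _ _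
  (@measurable_fun_id_completed R) (leb R) _ _ mD mf.
move=> <- //.
by move=> x /set_mem; exact: f0.
Qed.

Lemma integral_completed (R : realType) (D : set R) (f : R -> \bar R) :
  measurable D -> measurable_fun D f ->
  (\int[leb R]_(x in D) f x = \int[@lebesgue_measure R]_(x in D) f x)%E.
Proof.
move=> mD mf; rewrite integralE [RHS]integralE !ge0_integral_completed//.
- exact: measurable_funeneg.
- exact: measurable_funepos.
Qed.

Section majorant.
Context (R : realType).
Local Open Scope ereal_scope.

Notation mu := (@lebesgue_measure R).

(* The measure of A with density \sum_n c_n 1_{U_n}. *)
Definition weighted (c : nat -> R) (U : nat -> set R) (A : set R) : \bar R :=
  \sum_(0 <= n <oo) (c n)%:E * mu (U n `&` A).

Context (c : nat -> R) (U : nat -> set R).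
Context (c0 : forall n, (0 <= c n)%R) (oU : forall n, open (U n)).

Let term_ge0 A n : 0 <= (c n)%:E * mu (U n `&` A).
Proof. by rewrite mule_ge0 ?lee_fin. Qed.

Lemma weighted_ge0 A : 0 <= weighted c U A.
Proof. by apply: nneseries_ge0 => n _ _; exact: term_ge0. Qed.

Lemma le_weighted A B : measurable A -> measurable B -> A `<=` B ->
  weighted c U A <= weighted c U B.
Proof.
move=> mA mB AB; apply: lee_nneseries => n _ //.
rewrite lee_wpmul2l ?lee_fin// le_measure ?inE//.
- by apply: measurableI => //; exact: open_measurable.
- by apply: measurableI => //; exact: open_measurable.
- exact: setIS.
Qed.

Lemma weightedU A B : measurable A -> measurable B -> [disjoint A & B] ->
  weighted c U (A `|` B) = weighted c U A + weighted c U B.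
Proof.
move=> mA mB AB.
rewrite /weighted -nneseriesD//; [|by move=> *; exact: term_ge0..].
apply: eq_eseriesr => n _.
rewrite setIUr measureU ?ge0_muleDr//.
- by apply: measurableI => //; exact: open_measurable.
- by apply: measurableI => //; exact: open_measurable.
- by rewrite setIACA setIid (disj_set2P AB) ?setI0.
Qed.

Lemma weighted_ge n A : A `<=` U n -> (c n)%:E * mu A <= weighted c U A.
Proof.
move=> AU; apply: (@le_trans _ _ (\sum_(0 <= i < n.+1) (c i)%:E * mu (U i `&` A))).
  rewrite big_nat_recr//= (setIidr AU) leeDr//.
  by apply: sume_ge0 => i _; exact: term_ge0.
by apply: nneseries_lim_ge => i _ _; exact: term_ge0.
Qed.

End majorant.

(* The U_n are open supersets of the level sets [n e' <= k < (n + 1) e'], of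
   nearly the same measure, and c_n = (n + 1) e'. *)
Lemma open_level_cover (R : realType) (k : R -> R) (a b e : R) : a < b ->
  (forall x, a <= x <= b -> 0 <= k x) ->
  (leb R).-integrable `[a, b] (EFin \o k) -> 0 < e ->
  exists (c : nat -> R) (U : nat -> set R),
    [/\ forall n, 0 <= c n, forall n, open (U n),
        forall x, a <= x <= b -> exists2 n, U n x & k x <= c n &
        (weighted c U setT <= \int[leb R]_(x in `[a, b]) (k x)%:E + e%:E)%E].
Proof.
move=> ab k0 ik e0.
(* Rounding [k] up to the next level costs at most [eps * (b - a)] and the open enlargements cost at
   most [eps] in total; the denominator makes the sum equal to [e]. *)
pose eps := e / (b - a + 1).
have eps0 : 0 < eps by rewrite divr_gt0//; lra.
pose E n : set R := `[a, b] `&` k @^-1` `[n%:R * eps, n.+1%:R * eps[.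
pose c n : R := n.+1%:R * eps.
have c0 n : 0 < c n by rewrite mulr_gt0.
(* The division by [c n] is undone by the weight of [U n], which leaves a summable error. *)
pose d n := eps / (2 ^ n.+1)%:R / c n.
have d0 n : 0 < d n.
  by apply: divr_gt0 => //; apply: divr_gt0 => //; rewrite ltr0n expn_gt0.
pose U n := projT1 (cid (outer_measure_open_le (E n) (d0 n))).
have oU n : open (U n) by rewrite /U; case: cid => ? [].
have EU n : E n `<=` U n by rewrite /U; case: cid => ? [].
have muU n : (lebesgue_measure (U n) <= leb R (E n) + (d n)%:E)%E.
  by rewrite /U; case: cid => ? [].
have mab : measurable (`[a, b] : set (lebT R)).
  by apply: sub_caratheodory; exact: measurable_itv.
have mk : measurable_fun (`[a, b] : set (lebT R)) k.
  by apply/measurable_EFinP; exact: measurable_int ik.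
have mE n : measurable (E n : set (lebT R)).
  by apply: mk => //; exact: measurable_itv.
have tE : trivIset setT E.
  apply/trivIsetP => i j _ _ ij; apply/seteqP; split => // x /=.
  rewrite /E/= !in_itv/= => -[[_ /andP[ik1 ik2]] [_ /andP[jk1 jk2]]].
  move: ij; rewrite neq_ltn => /orP[] ij.
  - have : (i.+1%:R * eps <= j%:R * eps) by rewrite ler_pM2r// ler_nat.
    lra.
  - have : (j.+1%:R * eps <= i%:R * eps) by rewrite ler_pM2r// ler_nat.
    lra.
have UE : \bigcup_n E n = `[a, b]%classic.
  apply/seteqP; split => [x [n _ []]//|x /= xab].
  exists (Num.truncn (k x / eps)) => //; split => //=.
  have kx0 : 0 <= k x / eps.
    by rewrite divr_ge0 ?(ltW eps0)// k0//; move: xab; rewrite in_itv.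
  have /andP[] := truncn_itv kx0.
  by rewrite ler_pdivlMr// ltr_pdivrMr// in_itv/= => -> ->.
exists c, U; split => //.
- by move=> n; exact: ltW.
- move=> x xab; have : (\bigcup_n E n) x by rewrite UE/= in_itv.
  move=> [n _ Enx]; exists n; first exact: EU.
  by case: Enx => _ /=; rewrite in_itv/= => /andP[_ /ltW].
have mkE : measurable_fun (`[a, b] : set (lebT R)) (EFin \o k).
  exact/measurable_EFinP.
(* On [E n] the weight [c n] is at most [k + eps], so the level sets add up to an integral of
   [k + eps] over the whole segment. *)
have step n : ((c n)%:E * lebesgue_measure (U n `&` setT) <=
    \int[leb R]_(x in E n) (k x + eps)%:E + (eps / (2 ^ n.+1)%:R)%:E)%E.
  rewrite setIT (le_trans (lee_wpmul2l _ (muU n))) ?lee_fin ?(ltW (c0 n))//.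
  rewrite ge0_muleDr ?lee_fin ?(ltW (d0 n))// -EFinM.
  rewrite leeD//; last by rewrite lee_fin /d mulrC divfK ?gt_eqF.
  rewrite -integral_cst; last exact: mE.
  apply: ge0_le_integral; [exact: mE| |exact: measurable_cst| |].
  - by move=> x _; rewrite lee_fin ltW.
  - apply/measurable_EFinP; apply: measurable_funD => //.
    apply: measurable_funS mk => //; exact: subIsetl.
  - move=> x [_ /=]; rewrite in_itv/= => /andP[kn _].
    by rewrite lee_fin /c -natr1 mulrDl mul1r lerD2r.
apply: (@le_trans _ _ (\sum_(0 <= n <oo)
    (\int[leb R]_(x in E n) (k x + eps)%:E + (eps / (2 ^ n.+1)%:R)%:E))%E).
  apply: lee_nneseries => // n _ _.
  by rewrite mule_ge0 ?lee_fin ?(ltW (c0 n)).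
have pos n x : E n x -> (0 <= (k x + eps)%:E)%E.
  move=> [/= + _]; rewrite in_itv/= => /k0 ?.
  by rewrite lee_fin addr_ge0// ltW.
rewrite (le_trans (epsilon_trick _ _ _)) ?(ltW eps0)//.
  by move=> n; apply: integral_ge0 => x; exact: pos.
rewrite -ge0_integral_bigcup; [|exact: mE| | |exact: tE]; last 2 first.
- rewrite UE; apply/measurable_EFinP; exact: measurable_funD.
- by move=> x [n _]; exact: pos.
rewrite UE.
under eq_integral do rewrite EFinD.
rewrite ge0_integralD//=; last by move=> x _; rewrite lee_fin ltW.
rewrite integral_cst//= -addeA leeD2l//.
have -> : leb R `[a, b] = (b - a)%:E.
  rewrite -(_ : @lebesgue_measure R `[a, b] = leb R `[a, b])//.
  by rewrite lebesgue_measure_itv/= lte_fin ab EFinB.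
have eE : e = eps * (b - a + 1) by rewrite /eps divfK// gt_eqF//; lra.
by rewrite -EFinM -EFinD lee_fin eE (mulrDr _ (b - a)) mulr1.
Qed.

(** Openness of the sets [U n] is decisive: [x] lies in some [U n] with [k x <= c n], so the
    weighted measure has density at least [k x] on a whole neighbourhood of [x]. *)
Lemma monotone_majorant (R : realType) (k : R -> R) (a b e : R) : a < b ->
  (forall x, a <= x <= b -> 0 <= k x) ->
  (leb R).-integrable `[a, b] (EFin \o k) -> 0 < e ->
  exists V : R -> R, [/\ {homo V : x y / x <= y},
    V b - V a <= \int[leb R]_(x in `[a, b]) k x + e &
    forall x, a <= x <= b -> \forall y \near x,
      k x * `|y - x| <= `|V y - V x| ].
Proof.
move=> ab k0 ik e0.
have [c [U [c0 oU kU leT]]] := open_level_cover ab k0 ik e0.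
have mab : measurable (`[a, b] : set (lebT R)).
  by apply: sub_caratheodory; exact: measurable_itv.
have fint : (\int[leb R]_(x in `[a, b]) (k x)%:E)%E \is a fin_num.
  exact: integrable_fin_num.
have wfin A : measurable A -> weighted c U A \is a fin_num.
  move=> mA; rewrite ge0_fin_numE ?weighted_ge0//.
  rewrite (le_lt_trans (le_weighted c0 oU mA measurableT _))//.
  rewrite (le_lt_trans leT)// ltey_eq; apply/orP; left.
  by rewrite fin_numD fint.
(* The distribution function of the weighted measure; [fine] is faithful here because the total mass
   is finite. *)
pose V x := fine (weighted c U `]-oo, x]).
have VE x y : x <= y -> V y - V x = fine (weighted c U `]x, y]).
  move=> xy; rewrite /V.
  have -> : `]-oo, y]%classic = `]-oo, x] `|` `]x, y] :> set R.
    by rewrite -itv_bndbnd_setU.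
  rewrite weightedU//.
    by rewrite fineD ?wfin// addrAC subrr add0r.
  apply/disj_set2P/seteqP; split => // z [] /=; rewrite !in_itv/=; lra.
have ndV : {homo V : x y / x <= y}.
  by move=> x y xy; rewrite -subr_ge0 VE// fine_ge0// weighted_ge0.
exists V; split => //.
  rewrite VE ?(ltW ab)// -lee_fin fineK ?wfin//.
  rewrite EFinD /Rintegral fineK// (le_trans _ leT)//.
  exact: le_weighted.
have loc n x y : x <= y -> `]x, y] `<=` U n -> c n * (y - x) <= V y - V x.
  move=> xy xyU; rewrite VE// -lee_fin fineK ?wfin// (le_trans _ (weighted_ge c0 xyU))//.
  rewrite EFinM lebesgue_measure_itv/= lte_fin; case: ltP => // yx.
  by rewrite mule0 -EFinM lee_fin mulr_ge0_le0// subr_le0.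
move=> x /kU[n Unx kn].
have [d /= d0 dU] : nbhs x (U n) by apply: open_nbhs_nbhs; split.
near=> y.
have yd : `|x - y| < d by near: y; exists d.
have subU z : `|x - z| <= `|x - y| -> U n z.
  by move=> xz; apply: dU; rewrite /ball_/= (le_lt_trans xz).
apply: (@le_trans _ _ (c n * `|y - x|)); first by rewrite ler_wpM2r.
have [xy|/ltW yx] := leP x y.
  rewrite !ger0_norm ?subr_ge0 ?ndV//; apply: loc => // z /=.
  rewrite in_itv/= => /andP[xz zy]; apply: subU.
  rewrite distrC [leRHS]distrC !ger0_norm; lra.
rewrite distrC [leRHS]distrC !ger0_norm ?subr_ge0 ?ndV//; apply: loc => // z /=.
rewrite in_itv/= => /andP[xz zy]; apply: subU.
rewrite !ger0_norm; lra.
Unshelve. all: by end_near. Qed.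

(** * The recurrence of the Gamma function *)

Lemma derivable_powR_gt0 (R : realType) (s x : R) : 0 < x ->
  derivable (fun y : R => y `^ s) x 1.
Proof. by move=> x0; have [] := is_derive1_powR s x0. Qed.

Lemma continuous_powR (R : realType) (s x : R) : 0 < x ->
  {for x, continuous (fun y : R => y `^ s)}.
Proof.
by move=> /derivable_powR_gt0 d; apply/differentiable_continuous/derivable1_diffP.
Qed.

(** Raise [u <= expR u], at [u = t / (2 * s)], to the power [s]. Only half of the exponential is
    spent: against [expR (- t)] there remains [expR (- (t / 2))]. *)
Lemma powR_le_expR (R : realType) (s t : R) : 0 < s -> 0 <= t ->
  t `^ s <= (2 * s) `^ s * expR (t / 2).
Proof.
move=> s0 t0; have s20 : 0 < 2 * s by rewrite mulr_gt0.
have -> : expR (t / 2) = expR (t / (2 * s)) `^ s.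
  by rewrite -expRM; congr expR; field; rewrite gt_eqF.
rewrite -powRM ?expR_ge0 ?(ltW s20)//.
apply: (ge0_ler_powR (ltW s0)); rewrite ?nnegrE ?mulr_ge0 ?expR_ge0 ?(ltW s0) ?(ltW s20)//.
rewrite -ler_pdivrMl// mulrC (le_trans _ (expR_ge1Dx _))// lerDr//.
Qed.

Lemma cvgy_expR_half (R : realType) : expR (- (t / 2 : R)) @[t --> +oo] --> 0.
Proof.
have half_cvg : (t / 2 : R) @[t --> +oo] --> +oo.
  by apply: gt0_cvgMly; rewrite ?invr_gt0//; exact: cvg_id.
exact: (cvg_comp _ _ half_cvg (@cvgr_expR R)).
Qed.

Section Gamma_integral.
Context {R : realType}.
Notation mu := (@lebesgue_measure R).

(* Kept extended-real valued: a divergent integral would make Gamma equal to 0. *)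
Definition Gamma_integral (s : R) : \bar R :=
  (\int[mu]_(t in `]0%R, +oo[) (t `^ (s - 1) * expR (- t))%:E)%E.

Let ge0_integrand (s t : R) : 0 <= t `^ s * expR (- t).
Proof. by rewrite mulr_ge0 ?powR_ge0 ?expR_ge0. Qed.

Lemma measurable_Gamma_integrand (s : R) (D : set R) :
  measurable_fun D (fun t => t `^ s * expR (- t)).
Proof.
apply: measurable_funTS; apply: measurable_funM.
  exact: measurable_powR.
exact: (measurableT_comp (@measurable_expR R)).
Qed.

(** The majorant [f] has the explicit primitive [F], which vanishes at infinity. With the shift by 1
    the exponent of t is [s > 0], so there is no singularity at 0. *)
Lemma Gamma_integralS_lty (s : R) : 0 < s -> (Gamma_integral (s + 1) < +oo)%E.
Proof.
move=> s0; pose c := (2 * s) `^ s.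
have c0 : 0 <= c by exact: powR_ge0.
pose f (t : R) := c * expR (- (t / 2)).
pose F (t : R) := - 2 * c * expR (- (t / 2)).
have dF (t : R) : is_derive t 1 F (f t).
  by apply: is_derive_eq; rewrite /f /GRing.scale/=; field.
have cF (t : R) : {for t, continuous F}.
  by apply/differentiable_continuous/derivable1_diffP; case: (dF t).
have cf (t : R) : {for t, continuous f}.
  have -> : f = (fun t => (- 2^-1) * F t).
    by apply/funext => u; rewrite /F /f; field.
  apply: continuousM; [exact: cst_continuous|exact: cF].
have If : (\int[mu]_(t in `[0%R, +oo[) (f t)%:E = (0 : R)%:E - (F 0%R)%:E)%E.
  apply: ge0_continuous_FTC2y.
  - by move=> t _; rewrite mulr_ge0 ?expR_ge0.
  - by apply: continuous_in_subspaceT => t _; exact: cf.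
  - rewrite -(mulr0 (- 2 * c)); apply: cvgMr.
    exact: cvgy_expR_half.
  - by move=> t _; case: (dF t).
  - by apply: cvg_at_right_filter; exact: cF.
  - by move=> t _; rewrite derive1E; case: (dF t).
have mf : measurable_fun setT f.
  by apply: continuous_measurable_fun => t; exact: cf.
rewrite /Gamma_integral addrK.
apply: (@le_lt_trans _ _ (\int[mu]_(t in `[0%R, +oo[) (f t)%:E)%E); last first.
  by rewrite If -EFinB ltry.
rewrite -integral_itv_obnd_cbnd; last first.
  by apply/measurable_EFinP; exact: measurable_funTS.
apply: ge0_le_integral => //.
- by move=> t _; rewrite lee_fin.
- by apply/measurable_EFinP; exact: measurable_Gamma_integrand.
- by apply/measurable_EFinP; exact: measurable_funTS.
- move=> t /=; rewrite in_itv/= andbT => t0.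
  rewrite lee_fin (le_trans (ler_wpM2r _ (powR_le_expR s0 (ltW t0)))) ?expR_ge0//.
  by rewrite /f -mulrA -expRD (_ : t / 2 - t = - (t / 2))//; lra.
Qed.

(** The segment from 1 to 2 already contributes: there t^(s-1) = t^s / t is at least 1/2. *)
Lemma Gamma_integral_gt0 (s : R) : 0 < s -> (0 < Gamma_integral s)%E.
Proof.
move=> s0.
have sub : `[1%R, 2%R] `<=` (`]0%R, +oo[ : set R).
  by move=> x /=; rewrite !in_itv/=; lra.
rewrite (@lt_le_trans _ _ (\int[mu]_(t in `[1%R, 2%R]) (2^-1 * expR (- 2))%:E)%E)//.
  rewrite integral_cst//= lebesgue_measure_itv/= lte_fin ltr1n -EFinB -EFinM.
  by rewrite lte_fin !mulr_gt0 ?expR_gt0//; lra.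
apply: (@le_trans _ _ (\int[mu]_(t in `[1%R, 2%R]) (t `^ (s - 1) * expR (- t))%:E)%E).
  apply: ge0_le_integral => //.
  - by apply/measurable_EFinP; exact: measurable_Gamma_integrand.
  - move=> t /=; rewrite in_itv/= => /andP[t1 t2]; rewrite lee_fin ler_pM ?expR_ge0//.
      rewrite powRB; last by apply/implyP => _; lra.
      rewrite powRr1; last lra.
      rewrite ler_pdivlMr; last lra.
      rewrite (@le_trans _ _ 1)//; first lra.
      by rewrite -(powRr0 t) ler_powR// ltW.
    by rewrite ler_expR; lra.
apply: ge0_subset_integral => //.
- by apply/measurable_EFinP; exact: measurable_Gamma_integrand.
- by move=> t _; rewrite lee_fin.
Qed.

(** The segment stays away from 0, where t^(s-1) may blow up. *)
Lemma Gamma_integral_parts (s u v : R) : 0 < s -> 0 < u -> u < v ->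
  (\int[mu]_(t in `[u, v]) (t `^ s * expR (- t))%:E =
   (u `^ s * expR (- u) - v `^ s * expR (- v))%:E
   + s%:E * \int[mu]_(t in `[u, v]) (t `^ (s - 1) * expR (- t))%:E)%E.
Proof.
move=> s0 u0 uv.
have dF (t : R) : 0 < t -> is_derive t 1 (fun t : R => t `^ s) (s * t `^ (s - 1)).
  exact: is_derive1_powR.
have dG (t : R) : is_derive t 1 (fun t : R => - expR (- t)) (expR (- t)).
  by apply: is_derive_eq; rewrite /GRing.scale/=; ring.
have cG (t : R) : {for t, continuous (fun t : R => - expR (- t))}.
  by apply/differentiable_continuous/derivable1_diffP; case: (dG t).
have uv0 (t : R) : u <= t -> 0 < t by exact: lt_le_trans.
have := @integration_by_parts R (fun t => t `^ s) (fun t => - expR (- t))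
  (fun t => s * t `^ (s - 1)) (fun t => expR (- t)) u v uv.
move=> ->.
- rewrite EFinB EFinM; congr (_ + _)%E.
    by congr (_%:E); ring.
  under eq_integral do rewrite mulrN EFinN.
  rewrite integral_ge0N; last first.
    by move=> t _; rewrite lee_fin mulr_ge0 ?expR_ge0 ?mulr_ge0 ?powR_ge0 ?ltW.
  rewrite oppeK -ge0_integralZl//=.
  - by under eq_integral do rewrite -mulrA EFinM.
  - by apply/measurable_EFinP; exact: measurable_Gamma_integrand.
  - by move=> t _; rewrite lee_fin.
  - by rewrite lee_fin ltW.
- apply: continuous_in_subspaceT => t /set_mem /=; rewrite in_itv/= => /andP[/uv0 t0 _].
  by apply: cvgM; [exact: cvg_cst|exact: continuous_powR].
- split.
  + by move=> t; rewrite in_itv/= => /andP[/ltW/uv0/dF[]].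
  + by apply/cvg_at_right_filter; exact: continuous_powR.
  + by apply/cvg_at_left_filter; apply: continuous_powR; exact: lt_trans uv.
- by move=> t; rewrite in_itv/= derive1E => /andP[/ltW/uv0/dF[]].
- apply: continuous_in_subspaceT => t _.
  rewrite (_ : (fun x => expR (- x)) = (fun x => - - expR (- x))).
    by apply: cvgN; exact: cG.
  by apply/funext => x; rewrite opprK.
- split.
  + by move=> t _; case: (dG t).
  + by apply/cvg_at_right_filter; exact: cG.
  + by apply/cvg_at_left_filter; exact: cG.
- by move=> t _; rewrite derive1E; case: (dG t).
Qed.

(** Integration by parts on segments exhausting the half-line: the integrals converge monotonically
    and the boundary terms tend to 0. The equality is between extended reals, with finiteness of
    [Gamma_integral s] still open. *)
Lemma Gamma_integralS (s : R) : 0 < s ->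
  (Gamma_integral (s + 1) = s%:E * Gamma_integral s)%E.
Proof.
move=> s0.
(* The offset 2 gives [u n < 1 < v n] already at [n = 0]. *)
pose u n : R := n.+2%:R^-1.
pose v n : R := n.+2%:R.
have u0 n : 0 < u n by rewrite invr_gt0.
have v1 n : 1 < v n by rewrite ltr1n.
have u1 n : u n < 1 by rewrite invf_lt1 ?ltr1n.
pose F n : set R := `[u n, v n]%classic.
have ndF : {homo F : n m / (n <= m)%N >-> (n <= m)%O}.
  move=> n m nm; apply/subsetPset; apply: subset_itv; rewrite bnd_simp.
    by rewrite lef_pV2 ?posrE// ler_nat.
  by rewrite ler_nat.
have UF : \bigcup_n F n = `]0, +oo[%classic.
  apply/seteqP; split => [x [n _ /=]|x /=].
    by rewrite /F/= !in_itv/= andbT => /andP[+ _]; exact: lt_le_trans.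
  rewrite in_itv/= andbT => x0.
  exists (maxn (Num.truncn x) (Num.truncn x^-1)) => //; rewrite /F/= in_itv/=.
  rewrite /u /v; apply/andP; split.
    rewrite -[leRHS]invrK lef_pV2 ?posrE ?invr_gt0//.
    rewrite (le_trans (ltW (truncnS_gt _)))// ler_nat !ltnS.
    by apply: ltnW; rewrite ltnS leq_maxr.
  rewrite (le_trans (ltW (truncnS_gt _)))// ler_nat !ltnS.
  by apply: ltnW; rewrite ltnS leq_maxl.
have cvgF r : (\int[mu]_(t in F n) (t `^ r * expR (- t))%:E)%E @[n --> \oo] -->
    (\int[mu]_(t in `]0%R, +oo[) (t `^ r * expR (- t))%:E)%E.
  rewrite -UF; apply: ge0_nondecreasing_set_cvg_integral => //.
  - by move=> n; exact: measurable_itv.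
  - by move=> n; apply/measurable_EFinP; exact: measurable_Gamma_integrand.
  - by move=> n x _; rewrite lee_fin.
have v_cvg : v n @[n --> \oo] --> +oo.
  have := @cvgr_idn R; rewrite -(cvg_shiftn 2).
  by under eq_cvg do rewrite /= addn2.
have r_cvg : (u n `^ s * expR (- u n) - v n `^ s * expR (- v n))
    @[n --> \oo] --> (0 : R).
  rewrite -[X in _ --> X](subrr 0); apply: cvgB.
    apply: (@squeeze_cvgr _ _ _ _ (cst 0) (fun n => u n `^ s)).
    - near=> n; rewrite /= mulr_ge0 ?powR_ge0 ?expR_ge0//=.
      by rewrite ler_piMr ?powR_ge0// expR_le1 oppr_le0 ltW.
    - exact: cvg_cst.
    - move/cvg_at_rightP : (powR_cvg0 s0); apply; split => //.
      by have := @cvg_harmonic R; rewrite -cvg_shiftS.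
  apply: (@squeeze_cvgr _ _ _ _ (cst 0) (fun n => (2 * s) `^ s * expR (- (v n / 2)))).
  - near=> n; rewrite /= mulr_ge0 ?powR_ge0 ?expR_ge0//=.
    have vn0 : 0 <= v n by [].
    rewrite (le_trans (ler_wpM2r _ (powR_le_expR s0 vn0))) ?expR_ge0//.
    by rewrite -mulrA -expRD (_ : v n / 2 - v n = - (v n / 2))//; lra.
  - exact: cvg_cst.
  - rewrite -[X in _ --> X](mulr0 ((2 * s) `^ s)); apply: cvgMr.
    exact: (cvg_comp _ _ v_cvg (@cvgy_expR_half R)).
have cvgR : (\int[mu]_(t in F n) (t `^ s * expR (- t))%:E)%E @[n --> \oo]
    --> (0%:E + s%:E * Gamma_integral s)%E.
  under eq_cvg => n do
    rewrite (Gamma_integral_parts s0 (u0 n) (lt_trans (u1 n) (v1 n))).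
  apply: cvgeD; [by rewrite fin_num_adde_defr| |].
    by apply: cvg_EFin; [near=> n|exact: r_cvg].
  by apply: cvgeZl => //; exact: cvgF.
rewrite -[RHS]add0e /Gamma_integral addrK.
exact: (cvg_unique _ (cvgF s) cvgR).
Unshelve. all: by end_near. Qed.
End Gamma_integral.

Lemma Gamma_ratio (R : realType) (s : R) : 0 < s -> Gamma (s + 1) / Gamma s = s.
Proof.
move=> s0.
have GE r : Gamma r = fine (Gamma_integral r).
  rewrite /Gamma /Rintegral integral_completed//; apply/measurable_EFinP.
  exact: measurable_Gamma_integrand.
have G0 := Gamma_integral_gt0 s0.
have Gfin : Gamma_integral s \is a fin_num.
  (* Were [Gamma_integral s] infinite, the recurrence would make [Gamma_integral (s + 1)] infinite
     too. *)
  rewrite ge0_fin_numE ?(ltW G0)// ltNge leye_eq; apply/negP => /eqP Goo.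
  have := Gamma_integralS_lty s0.
  by rewrite Gamma_integralS// Goo gt0_muley ?lte_fin// ltxx.
rewrite !GE Gamma_integralS// fineM// mulfK// gt_eqF// fine_gt0// G0.
by rewrite ltey_eq Gfin.
Qed.

(** * A primitive of the weighted derivative *)

(** Meant for powers that blow up at an endpoint. On closed segments inside the interval the
    integral is an increment of the bounded primitive [F], hence at most [M + M], and monotone
    convergence reaches the whole interval. *)
Lemma ge0_integrable_oo (R : realType) (f F : R -> R) (a b M : R) : a < b ->
  (forall x, a < x < b -> 0 <= f x) ->
  (forall x, a < x < b -> {for x, continuous f}) ->
  (forall x, a < x < b -> is_derive x 1 F (f x)) ->
  (forall x, a < x < b -> `|F x| <= M) ->
  (@lebesgue_measure R).-integrable `]a, b[ (EFin \o f).
Proof.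
move=> ab f0 cf dF FM.
have mf : measurable_fun `]a, b[ f.
  apply: open_continuous_measurable_fun; first exact: interval_open.
  by move=> x /set_mem; rewrite /= in_itv/=; exact: cf.
(* The denominator [n.+3] keeps [d n] strictly below half the length, so that [u n < v n] below. *)
have [d [d0 d2 dle dm]] : exists d : nat -> R, [/\ forall n, 0 < d n,
    forall n, d n < (b - a) / 2, forall n m, (n <= m)%N -> d m <= d n &
    forall m, 0 < m -> exists n, d n <= m].
  exists (fun n => (b - a) / n.+3%:R); split => [n|n|n m nm|m m0].
  - by rewrite divr_gt0// subr_gt0.
  - by rewrite ltr_pM2l ?subr_gt0// ltf_pV2 ?posrE// ltr_nat.
  - by rewrite ler_pM2l ?subr_gt0// lef_pV2 ?posrE// ler_nat.
  - exists (Num.truncn ((b - a) / m)).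
    rewrite ler_pdivrMr// -ler_pdivrMl// mulrC (le_trans (ltW (truncnS_gt _)))//.
    by rewrite ler_nat !ltnS ltnW.
pose u n := a + d n.
pose v n := b - d n.
have uv n : u n < v n by rewrite /u /v; have := d2 n; lra.
have au n : a < u n by rewrite /u ltrDl.
have vb n : v n < b by rewrite /v ltrBlDr ltrDl.
pose E n : set R := `[u n, v n]%classic.
have Eab n x : u n <= x <= v n -> a < x < b.
  by move=> /andP[ux xv]; rewrite (lt_le_trans (au n))// (le_lt_trans xv).
have ndE : {homo E : n m / (n <= m)%N >-> (n <= m)%O}.
  move=> n m nm; apply/subsetPset.
  by apply: subset_itv; rewrite bnd_simp /u /v; have := dle _ _ nm; lra.
have UE : \bigcup_n E n = `]a, b[%classic.
  apply/seteqP; split => [x [n _]|x].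
    by rewrite /E/= !in_itv/=; exact: Eab.
  rewrite /= in_itv/= => /andP[ax xb].
  pose m := Num.min (x - a) (b - x).
  have m0 : 0 < m by rewrite lt_min !subr_gt0 ax.
  have [n dnm] := dm _ m0.
  by exists n => //; move: dnm; rewrite le_min /E/= in_itv/= /u /v => /andP[]; lra.
have cvgE : (\int[@lebesgue_measure R]_(t in E n) (f t)%:E)%E @[n --> \oo] -->
    (\int[@lebesgue_measure R]_(t in `]a, b[) (f t)%:E)%E.
  rewrite -UE; apply: ge0_nondecreasing_set_cvg_integral => //.
  - by move=> n; exact: measurable_itv.
  - move=> n; apply/measurable_EFinP; apply: measurable_funS mf => //.
    by move=> x; rewrite /E/= !in_itv/=; exact: Eab.
  - by move=> n x; rewrite /E/= in_itv/= => /Eab/f0; rewrite lee_fin.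
have leE n : (\int[@lebesgue_measure R]_(t in E n) (f t)%:E <= (M + M)%:E)%E.
  have cF x : a < x < b -> {for x, continuous F}.
    by move=> /dF[dFx _]; apply/differentiable_continuous/derivable1_diffP.
  have uab : a < u n < b by apply: (Eab n); rewrite lexx (ltW (uv n)).
  have vab : a < v n < b by apply: (Eab n); rewrite lexx (ltW (uv n)).
  rewrite (@continuous_FTC2 _ f F)//.
  - rewrite -EFinB lee_fin; have := FM _ uab; have := FM _ vab.
    by rewrite !ler_norml; lra.
  - apply: continuous_in_subspaceT => x /set_mem/=; rewrite in_itv/=.
    by move=> /Eab/cf.
  - split.
    + by move=> x; rewrite in_itv/= => /andP[? ?]; have [] := dF x (Eab n _ _); rewrite ?ltW.
    + by apply/cvg_at_right_filter; exact: cF.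
    + by apply/cvg_at_left_filter; exact: cF.
  - move=> x; rewrite in_itv/= derive1E => /andP[? ?].
    by have [] := dF x (Eab n _ _); rewrite ?ltW.
apply/integrableP; split; first exact/measurable_EFinP.
apply: (@le_lt_trans _ _ (M + M)%:E); last exact: ltry.
under eq_integral.
  move=> x /set_mem/=; rewrite in_itv/= => /f0 fx0.
  by rewrite ger0_norm//; over.
rewrite -(cvg_lim _ cvgE)//; apply: lime_le.
  by apply/cvg_ex; eexists; exact: cvgE.
by near=> n; exact: leE.
Unshelve. all: by end_near. Qed.

Lemma is_derive_continuous (R : realType) (f : R -> R) (x l : R) :
  is_derive x 1 f l -> {for x, continuous f}.
Proof. by case=> ? _; apply/differentiable_continuous/derivable1_diffP. Qed.

Lemma is_derive_powR_subl (R : realType) (s a x : R) : a < x ->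
  is_derive x 1 (fun y : R => (y - a) `^ s) (s * (x - a) `^ (s - 1)).
Proof.
move=> ax; have xa0 : 0 < x - a by rewrite subr_gt0.
have dp := is_derive1_powR s xa0.
have dB : is_derive x 1 (fun y : R => y - a) 1.
  by apply: is_derive_eq; rewrite subr0.
have dc := @is_derive1_comp _ (fun y : R => y `^ s) (fun y : R => y - a) x _ _ dp dB.
by apply: (is_derive_eq dc); rewrite mulr1.
Qed.

Lemma is_derive_powR_subr (R : realType) (s b x : R) : x < b ->
  is_derive x 1 (fun y : R => (b - y) `^ s) (- (s * (b - x) `^ (s - 1))).
Proof.
move=> xb; have bx0 : 0 < b - x by rewrite subr_gt0.
have dp := is_derive1_powR s bx0.
have dB : is_derive x 1 (fun y : R => b - y) (-1).
  by rewrite -[X in is_derive _ _ _ X]add0r; exact: is_deriveB.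
have dc := @is_derive1_comp _ (fun y : R => y `^ s) (fun y : R => b - y) x _ _ dp dB.
by apply: (is_derive_eq dc); rewrite mulrN1.
Qed.

Lemma integrable_powR_subl (R : realType) (s a b : R) : 0 < s -> a < b ->
  (@lebesgue_measure R).-integrable `]a, b[ (fun x => ((x - a) `^ (s - 1))%:E).
Proof.
move=> s0 ab.
apply: (@ge0_integrable_oo _ _ (fun x => s^-1 * (x - a) `^ s) _ _
  (s^-1 * (b - a) `^ s) ab).
- by move=> x _; exact: powR_ge0.
- by move=> x /andP[ax _]; apply: is_derive_continuous; exact: is_derive_powR_subl.
- move=> x /andP[ax _].
  have dz := @is_deriveZ _ _ _ _ s^-1 x 1 _ (is_derive_powR_subl s ax).
  by apply: (is_derive_eq dz); rewrite /GRing.scale/= mulKf// gt_eqF.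
- move=> x /andP[ax xb]; rewrite ger0_norm; last first.
    by rewrite mulr_ge0 ?powR_ge0 ?invr_ge0 ?ltW.
  rewrite ler_pM2l ?invr_gt0//; apply: (ge0_ler_powR (ltW s0)); rewrite ?nnegrE; lra.
Qed.

Lemma integrable_powR_subr (R : realType) (s a b : R) : 0 < s -> a < b ->
  (@lebesgue_measure R).-integrable `]a, b[ (fun x => ((b - x) `^ (s - 1))%:E).
Proof.
move=> s0 ab.
apply: (@ge0_integrable_oo _ _ (fun x => (- s^-1) * (b - x) `^ s) _ _
  (s^-1 * (b - a) `^ s) ab).
- by move=> x _; exact: powR_ge0.
- by move=> x /andP[_ xb]; apply: is_derive_continuous; exact: is_derive_powR_subr.
- move=> x /andP[_ xb].
  have dz := @is_deriveZ _ _ _ _ (- s^-1) x 1 _ (is_derive_powR_subr s xb).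
  by apply: (is_derive_eq dz); rewrite /GRing.scale/= mulrNN mulKf// gt_eqF.
- move=> x /andP[ax xb]; rewrite normrM normrN !ger0_norm ?powR_ge0 ?invr_ge0 ?(ltW s0)//.
  rewrite ler_pM2l ?invr_gt0//; apply: (ge0_ler_powR (ltW s0)); rewrite ?nnegrE; lra.
Qed.

Lemma integrable_itv_oo_cc (R : realType) (f : R -> R) (a b : R) :
  measurable_fun `[a, b] f ->
  (@lebesgue_measure R).-integrable `]a, b[ (EFin \o f) ->
  (@lebesgue_measure R).-integrable `[a, b] (EFin \o f).
Proof.
move=> mf /integrableP[_ f_lty]; apply/integrableP; split.
  exact/measurable_EFinP.
have mnf (i : interval R) : [set` i] `<=` `[a, b] ->
    measurable_fun [set` i] (fun x => `|(f x)%:E|)%E.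
  move=> iab; apply: measurableT_comp => //; apply/measurable_EFinP.
  by apply: measurable_funS mf.
rewrite -integral_itv_bndo_bndc; last first.
  by apply: mnf => x; exact: subset_itv_co_cc.
rewrite -integral_itv_obnd_cbnd//.
by apply: mnf => x; exact: subset_itv_oo_cc.
Qed.

(** Covers the endpoint, which the derivative formulas miss because they ask for a positive base. *)
Lemma cvg_powR_subl (R : realType) (s a : R) : 0 < s ->
  (x - a) `^ s @[x --> a^'+] --> 0.
Proof.
move=> s0; apply: (@increasing_cvg_at_right_comp _ (fun x => x - a)
  (fun y => y `^ s) a +oo%O) => //.
- by move=> x y _ _ xy; rewrite ltrD2r.
- by apply/cvg_at_right_filter; apply: cvgB; [exact: cvg_id|exact: cvg_cst].
- by rewrite subrr; exact: powR_cvg0.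
Qed.

Lemma cvg_powR_subr (R : realType) (s b : R) : 0 < s ->
  (b - x) `^ s @[x --> b^'-] --> 0.
Proof.
move=> s0; apply: (@decreasing_cvg_at_left_comp _ (fun x => b - x)
  (fun y => y `^ s) -oo%O b) => //.
- by move=> x y _ _ xy; rewrite ltrD2l ltrN2.
- by apply/cvg_at_left_filter; apply: cvgB; [exact: cvg_cst|exact: cvg_id].
- by rewrite subrr; exact: powR_cvg0.
Qed.

(** Moving the derivative from [f] to the weight leaves the product of an integrable function and of
    [f], which is continuous and so bounded on the segment. The two halves of its integral are the
    Riemann-Liouville integrals up to constants. *)
Lemma fractional_primitive (R : realType) (f : R -> R) (s a b : R) :
  0 < s -> a < b -> (forall x, a <= x <= b -> derivable f x 1) ->
  exists G : R -> R, [/\ {within `[a, b], continuous G},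
    forall x, a < x < b -> is_derive x 1 G
      (((x - a) `^ s - (b - x) `^ s) / (b - a) `^ s * derive1 f x) &
    G b - G a = f a + f b - Gamma (s + 1) / (b - a) `^ s *
      (RL_left s a f b + RL_right s b f a)].
Proof.
move=> s0 ab df.
pose K := ((b - a) `^ s)^-1.
have K_neq0 : (b - a) `^ s != 0 by rewrite gt_eqF// powR_gt0// subr_gt0.
(* The factor [K] makes [W a = -1] and [W b = 1], the source of [f a + f b]. *)
pose W x := K * ((x - a) `^ s - (b - x) `^ s).
pose p1 x := (x - a) `^ (s - 1) : R.
pose p2 x := (b - x) `^ (s - 1) : R.
pose w x := K * s * (p1 x + p2 x).
have dW x : a < x < b -> is_derive x 1 W (w x).
  move=> /andP[ax xb].
  have dz := @is_deriveZ _ _ _ _ K x 1 _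
    (is_deriveB (is_derive_powR_subl s ax) (is_derive_powR_subr s xb)).
  by apply: (is_derive_eq dz); rewrite /GRing.scale/= /w /p1 /p2; ring.
have cW : {within `[a, b], continuous W}.
  apply/(continuous_within_itvP _ ab); split.
  - by move=> x; rewrite in_itv/= => /dW/is_derive_continuous.
  - apply: cvgM; first exact: cvg_cst.
    rewrite subrr powR0 ?gt_eqF//; apply: cvgB; first exact: cvg_powR_subl.
    apply/cvg_at_right_filter.
    exact: (is_derive_continuous (is_derive_powR_subr s ab)).
  - apply: cvgM; first exact: cvg_cst.
    rewrite subrr powR0 ?gt_eqF//; apply: cvgB; last exact: cvg_powR_subr.
    apply/cvg_at_left_filter.
    exact: (is_derive_continuous (is_derive_powR_subl s ab)).
have cf : {within `[a, b], continuous f}.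
  by apply: derivable_within_continuous => x; rewrite in_itv/=; exact: df.
have mf : measurable_fun `[a, b] f by exact: subspace_continuous_measurable_fun.
have bf : [bounded f x | x in (`[a, b] : set R)].
  have /compact_bounded[M [_ fM]] := continuous_compact cf (@segment_compact _ a b).
  by exists M; split; rewrite ?num_real// => y My x xab; apply: fM My _ _; exists x.
have mp1 : measurable_fun setT p1.
  apply: (measurableT_comp (@measurable_powR R (s - 1))).
  exact: measurable_funB.
have mp2 : measurable_fun setT p2.
  apply: (measurableT_comp (@measurable_powR R (s - 1))).
  exact: measurable_funB.
have ipf (p : R -> R) : measurable_fun setT p ->
    (@lebesgue_measure R).-integrable `]a, b[ (EFin \o p) ->
    (@lebesgue_measure R).-integrable `[a, b] (fun x => (p x * f x)%:E).
  move=> mp ip.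
  have ip_cc := integrable_itv_oo_cc (measurable_funTS mp) ip.
  exact: (@integrableMl _ (measurableTypeR R) _ (@lebesgue_measure R) _
    (measurable_itv `[a, b]) (EFin \o p) f ip_cc mf bf).
have ip1 := ipf _ mp1 (integrable_powR_subl s0 ab).
have ip2 := ipf _ mp2 (integrable_powR_subr s0 ab).
have wfE x : w x * f x = K * s * (p1 x * f x + p2 x * f x).
  by rewrite /w; ring.
have mab : measurable (`[a, b]%classic : set (measurableTypeR R)).
  exact: measurable_itv.
have ipD : (@lebesgue_measure R).-integrable `[a, b]
    (fun x => (p1 x * f x + p2 x * f x)%:E).
  exact: (integrableD mab ip1 ip2).
have iwf : (@lebesgue_measure R).-integrable `[a, b] (fun x => (w x * f x)%:E).
  rewrite (_ : (fun x => _) =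
    (fun x => (K * s)%:E * (p1 x * f x + p2 x * f x)%:E)%E); last first.
    by apply/funext => x; rewrite wfE.
  exact: (integrableZl mab _ ipD).
pose P x := \int[@lebesgue_measure R]_(t in `[a, x]) (w t * f t).
have cP : {within `[a, b], continuous P}.
  exact: (parameterized_integral_continuous (ltW ab) iwf).
have dP x : a < x < b -> is_derive x 1 P (w x * f x).
  move=> axb; have /andP[ax xb] := axb.
  have cwf : {for x, continuous (fun t => w t * f t)}.
    apply: cvgM; last first.
      apply/differentiable_continuous/derivable1_diffP.
      by apply: df; rewrite (ltW ax) ltW.
    apply: cvgM; first exact: cvg_cst.
    apply: cvgD.
      exact: is_derive_continuous (is_derive_powR_subl _ ax).
    exact: is_derive_continuous (is_derive_powR_subr _ xb).
  have [dPx PxE] := continuous_FTC1_closed xb iwf ax cwf.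
  exact: (DeriveDef dPx (etrans (esym (derive1E _ _)) PxE)).
exists (fun x => W x * f x - P x); split.
- apply/subspace_continuousP => x xab; apply: cvgB; first apply: cvgM.
  + by move/subspace_continuousP : cW; exact.
  + by move/subspace_continuousP : cf; exact.
  + by move/subspace_continuousP : cP; exact.
- move=> x axb; have /andP[ax xb] := axb.
  have fx : is_derive x 1 f (derive1 f x).
    by rewrite derive1E; apply/derivableP; apply: df; rewrite (ltW ax) ltW.
  (* The term [w x * f x] of the product rule cancels against the derivative of [P]. *)
  have dG := is_deriveB (is_deriveM (dW _ axb) fx) (dP _ axb).
  apply: (is_derive_eq dG); rewrite /GRing.scale/= /W /K.
  by field.
(* Passes from the completed measure on the open interval, used by the fractional integrals, to the
   Borel measure on the closed one, used by [P]. *)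
have RE (p : R -> R) : measurable_fun setT p ->
    (@lebesgue_measure R).-integrable `[a, b] (fun x => (p x * f x)%:E) ->
    \int[leb R]_(t in `]a, b[) (p t * f t) =
    \int[@lebesgue_measure R]_(t in `[a, b]) (p t * f t).
  move=> mp ip.
  rewrite -Rintegral_itv_bndo_bndc; last first.
    by apply: integrableS ip => // x; exact: subset_itv_co_cc.
  rewrite -Rintegral_itv_obnd_cbnd; last first.
    by apply: integrableS ip => // x; exact: subset_itv_oo_cc.
  rewrite /Rintegral integral_completed//; apply/measurable_EFinP.
  apply: measurable_funM; first exact: measurable_funTS.
  by apply: measurable_funS mf => // x; exact: subset_itv_oo_cc.
pose I1 := \int[leb R]_(t in `]a, b[) (p1 t * f t).
pose I2 := \int[leb R]_(t in `]a, b[) (p2 t * f t).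
have PE : P b = K * s * (I1 + I2).
  rewrite /I1 /I2 !RE// -RintegralD// -RintegralZl//.
  by apply: eq_Rintegral => x _; exact: wfE.
have Pa0 : P a = 0 by rewrite /P set_itv1 Rintegral_set1.
have Wb : W b = 1 by rewrite /W subrr powR0 ?gt_eqF// subr0 /K mulVf.
have Wa : W a = -1 by rewrite /W subrr powR0 ?gt_eqF// sub0r mulrN /K mulVf.
(* Writing [s] as a quotient of Gamma values yields both the prefactor and the inverse [Gamma s]
   inside [RL_left] and [RL_right]. *)
rewrite Pa0 PE Wa Wb -[s in K * s](Gamma_ratio s0).
rewrite (_ : RL_left s a f b = (Gamma s)^-1 * I2)//.
rewrite (_ : RL_right s b f a = (Gamma s)^-1 * I1)// -/K.
move: (Gamma (s + 1)) (Gamma s) I1 I2 {PE} => g1 g2 I1 I2; ring.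
Qed.

(** * The trapezoid inequality *)

Lemma is_derive_near_lipschitz (R : realType) (G : R -> R) (x l e : R) :
  is_derive x 1 G l -> 0 < e ->
  \forall y \near x, `|G y - G x| <= (`|l| + e) * `|y - x|.
Proof.
move=> [dG lE] e0.
have : (fun h => h^-1 *: (G (h *: 1 + x) - G x)) @ 0^' --> l by rewrite -lE; exact: dG.
move=> /cvgrPdist_lt/(_ e e0)[d /= d0 near0].
exists d => //= y /=; rewrite distrC => yx_d.
have [->|yx] := eqVneq y x; first by rewrite !subrr normr0 mulr0.
have h0 : y - x != 0 by rewrite subr_eq0.
have := near0 (y - x); rewrite /ball_/= sub0r normrN => /(_ yx_d h0).
rewrite /GRing.scale/= mulr1 subrK; set q := _^-1 * _ => /ltW lq_e.
have -> : G y - G x = q * (y - x) by rewrite mulrC /q mulVKf.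
rewrite normrM ler_wpM2r// -[q](subKr l).
by rewrite (le_trans (ler_normB _ _))// lerD2l.
Qed.

(** Invexity is out of the picture here: preinvexity survives only as the bound on the derivative
    along the segment, with [A] and [B] in place of its absolute values at the two given points. *)
Lemma fractional_trapezoid_bound (R : realType) (f h : R -> R) (s a c A B : R) :
  0 < s -> 0 < c -> 0 <= A -> 0 <= B ->
  (forall x, a <= x <= a + c -> derivable f x 1) ->
  (forall t : R, 0 <= t <= 1 -> 0 <= h t) ->
  (leb R).-integrable `[0, 1]
    (fun t : R => (`|(1 - t) `^ s - t `^ s| * h t)%:E) ->
  (forall t : R, 0 <= t <= 1 ->
    `|derive1 f (a + t * c)| <= h (1 - t) * A + h t * B) ->
  `|f a + f (a + c) - Gamma (s + 1) / c `^ s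
      * (RL_left s a f (a + c) + RL_right s (a + c) f a)|
  <= c * (A + B) * \int[leb R]_(t in `[0, 1]) (`|(1 - t) `^ s - t `^ s| * h t).
Proof.
move=> s0 c0 A0 B0 df h0 ik f'_le.
pose b := a + c.
have ab : a < b by rewrite ltrDl.
pose k t := `|(1 - t) `^ s - t `^ s| * h t.
have k0 (t : R) : 0 <= t <= 1 -> 0 <= k t.
  by move=> t01; rewrite mulr_ge0// h0.
have [G [cG dG GE]] := fractional_primitive s0 ab df.
have bac : b - a = c by rewrite /b addrAC subrr add0r.
rewrite bac in dG GE.
rewrite -/b -GE; apply/ler_addgt0Pr => e e0.
(* [Phi b - Phi a] will exceed the target by at most [c * (A + B) * e'], from [V], plus [c * e'],
   from the linear term of [Phi]. *)
have AB1 : 0 < c * (A + B + 1) by rewrite mulr_gt0// ltr_wpDl// addr_ge0.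
have [e' e'0 e'E] : exists2 e', 0 < e' & c * (A + B + 1) * e' = e.
  by exists (e / (c * (A + B + 1))); rewrite ?divr_gt0// mulrC divfK// gt_eqF.
have [V [ndV leV nearV]] := monotone_majorant ltr01 k0 ik e'0.
(* The outer [c] undoes the rescaling to the unit segment, the minus sign makes the reflected term
   nondecreasing, and [e' * x] absorbs the error of the difference quotient of [G]. *)
pose Phi x := c * (B * V ((x - a) / c) - A * V ((b - x) / c)) + e' * x.
have ndVl (x y : R) : x <= y -> V ((x - a) / c) <= V ((y - a) / c).
  by move=> xy; apply: ndV; rewrite ler_pM2r ?invr_gt0// lerD2r.
have ndVr (x y : R) : x <= y -> V ((b - y) / c) <= V ((b - x) / c).
  by move=> xy; apply: ndV; rewrite ler_pM2r ?invr_gt0// lerD2l lerN2.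
have PhiB (x y : R) : Phi y - Phi x = c * B * (V ((y - a) / c) - V ((x - a) / c)) +
    c * A * (V ((b - x) / c) - V ((b - y) / c)) + e' * (y - x).
  by rewrite /Phi; ring.
(* The three contributions to an increment have the same sign, so their absolute values add up. *)
have PhiE (x y : R) : `|Phi y - Phi x| = c * B * `|V ((y - a) / c) - V ((x - a) / c)| +
    c * A * `|V ((b - y) / c) - V ((b - x) / c)| + e' * `|y - x|.
  wlog xy : x y / x <= y => [wlog_le|].
    have [/wlog_le//|/ltW/wlog_le] := leP x y.
    by rewrite distrC (distrC (V ((x - a) / c))) (distrC (V ((b - x) / c))) (distrC x).
  rewrite PhiB (distrC (V ((b - y) / c))).
  rewrite !(ger0_norm (_ : 0 <= _ - _)) ?subr_ge0 ?ndVl ?ndVr//.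
  rewrite ger0_norm// !addr_ge0// ?mulr_ge0 ?subr_ge0 ?ndVl ?ndVr// ltW//.
have ndPhi : {homo Phi : x y / x <= y}.
  move=> x y xy; rewrite -subr_ge0 PhiB.
  rewrite !addr_ge0// ?mulr_ge0 ?subr_ge0 ?ndVl ?ndVr// ltW//.
apply: (@le_trans _ _ (Phi b - Phi a)).
  apply: le_increment => // x axb; have /andP[ax xb] := axb.
  have [t t_def] : exists t, (x - a) / c = t by exists ((x - a) / c).
  have xE : x = a + t * c by rewrite -t_def divfK ?gt_eqF// addrC subrK.
  have tE : (b - x) / c = 1 - t.
    by rewrite xE /b; field; rewrite gt_eqF.
  have t01 : 0 <= t <= 1.
    rewrite -t_def ler_pdivlMr// ler_pdivrMr// mul0r mul1r subr_ge0 (ltW ax)/=.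
    by rewrite lerBlDl ltW.
  have t01' : 0 <= 1 - t <= 1 by rewrite subr_ge0 lerBlDl lerDr andbC.
  have l_le : `|((x - a) `^ s - (b - x) `^ s) / c `^ s * derive1 f x| <=
      A * k (1 - t) + B * k t.
    have -> : ((x - a) `^ s - (b - x) `^ s) / c `^ s = t `^ s - (1 - t) `^ s.
      have -> : x - a = t * c by rewrite xE; ring.
      have -> : b - x = (1 - t) * c by rewrite xE /b; ring.
      have /andP[t0 t1] := t01; have /andP[t0' _] := t01'.
      by rewrite !powRM ?(ltW c0)// -mulrBl mulfK// gt_eqF// powR_gt0.
    rewrite normrM xE (le_trans (ler_wpM2l _ (f'_le t t01)))//.
    (* The absolute value in [k] is invariant under the reflection of [t] to [1 - t]; only the
       argument of [h] changes. *)
    rewrite /k subKr (distrC ((1 - t) `^ s)).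
    by rewrite le_eqVlt; apply/orP; left; apply/eqP; ring.
  have cl : (y - a) / c @[y --> x] --> t.
    rewrite -t_def; apply: cvgM; last exact: cvg_cst.
    by apply: cvgB; [exact: cvg_id|exact: cvg_cst].
  have cr : (b - y) / c @[y --> x] --> 1 - t.
    rewrite -tE; apply: cvgM; last exact: cvg_cst.
    by apply: cvgB; [exact: cvg_cst|exact: cvg_id].
  have nearl : \forall y \near x, k t * `|(y - a) / c - t| <=
      `|V ((y - a) / c) - V t|.
    exact: (cl _ (nearV _ t01)).
  have nearr : \forall y \near x, k (1 - t) * `|(b - y) / c - (1 - t)| <=
      `|V ((b - y) / c) - V (1 - t)|.
    exact: (cr _ (nearV _ t01')).
  have nearG := is_derive_near_lipschitz (dG x axb) e'0.
  near=> y.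
  have Gy : `|G y - G x| <=
      (`|((x - a) `^ s - (b - x) `^ s) / c `^ s * derive1 f x| + e') * `|y - x|.
    by near: y.
  have Vl : k t * `|(y - a) / c - t| <= `|V ((y - a) / c) - V t| by near: y.
  have Vr : k (1 - t) * `|(b - y) / c - (1 - t)| <=
      `|V ((b - y) / c) - V (1 - t)| by near: y.
  have yxl : c * `|(y - a) / c - t| = `|y - x|.
    rewrite -{1}(gtr0_norm c0) -normrM; congr `|_|.
    by rewrite xE; field; rewrite gt_eqF.
  have yxr : c * `|(b - y) / c - (1 - t)| = `|y - x|.
    rewrite -{1}(gtr0_norm c0) -normrM distrC; congr `|_|.
    by rewrite xE /b; field; rewrite gt_eqF.
  rewrite (le_trans Gy)// PhiE tE t_def mulrDl lerD2r.
  rewrite (le_trans (ler_wpM2r _ l_le))// mulrDl addrC lerD//.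
    by rewrite -yxl mulrACA (mulrC B) ler_wpM2l// mulr_ge0// ltW.
  by rewrite -yxr mulrACA (mulrC A) ler_wpM2l// mulr_ge0// ltW.
rewrite PhiB !subrr !mul0r !bac divff ?gt_eqF//.
have := ler_wpM2l (mulr_ge0 (ltW c0) (addr_ge0 A0 B0)) leV.
(* The integral occurs in two convertible forms; both are named [K] before the linear arithmetic. *)
rewrite -e'E; set K := (X in _ <= _ * (X + _) -> _).
rewrite -[X in _ -> _ <= _ * X + _]/K.
by move: K (V 1) (V 0) => K v1 v0; lra.
Unshelve. all: by end_near. Qed.

Local Open Scope complex_scope.

Theorem theorem1 (R : realType) (phi : R) (eta : R -> R -> R) (I J : set R)
    (a b c alpha : R) (f h : R -> R)
    (phi_bounds : 0 <= phi <= pi / 2)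
    (I_open : open I)
    (I_invex : phi_invex phi eta I)
    (aI : I a) (bI : I b)
    (eta_gt0 : 0 < eta b a)
    (cE : c%:C = expi phi * (eta b a)%:C)
    (f_diff : forall x, I x -> derivable f x 1)
    (f'_L1 : (leb R).-integrable `[a, a + c] (fun x : R => (derive1 f x)%:E))
    (alpha_gt0 : 0 < alpha)
    (J_01 : `[0, 1] `<=` J)
    (h_ge0 : forall t, J t -> 0 <= h t)
    (h_int : (leb R).-integrable `[0, 1]
       (fun t : R => (`|(1 - t) `^ alpha - t `^ alpha| * h t)%:E))
    (f'_preinvex : h_phi_preinvex h phi eta I (fun x => `|derive1 f x|)) :
  `|f a + f (a + c)
    - Gamma (alpha + 1) / c `^ alpha
      * (RL_left alpha a f (a + c) + RL_right alpha (a + c) f a)|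
  <= c * (`|derive1 f a| + `|derive1 f b|)
     * \int[leb R]_(t in `[0, 1]) (`|(1 - t) `^ alpha - t `^ alpha| * h t).
Proof.
have c_Re : c = cos phi * eta b a.
  by have := congr1 (@complex.Re R) cE; rewrite /= mulr0 subr0.
have c_Im : sin phi = 0.
  have := congr1 (@complex.Im R) cE; rewrite /= mulr0 add0r => /esym/eqP.
  by rewrite mulf_eq0 (gt_eqF eta_gt0) orbF => /eqP.
(* The range of [phi] excludes a negative cosine, and [sin phi = 0] then excludes a zero one, so [c]
   has the sign of [eta b a]. *)
have cos_ge0 : 0 <= cos phi.
  have /andP[phi0 phi_le] := phi_bounds.
  by rewrite cos_ge0_pihalf// phi_le (le_trans _ phi0)// oppr_le0 divr_ge0// pi_ge0.
have c0 : 0 < c.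
  rewrite c_Re mulr_gt0// lt_neqAle cos_ge0 andbT eq_sym; apply/eqP => cos0.
  have := cos2Dsin2 phi; rewrite cos0 c_Im expr0n/= addr0 => /eqP.
  by rewrite eq_sym oner_eq0.
have pointE t : phi_point phi eta a b t = (a + t * c)%:C.
  by rewrite /phi_point -mulrA -cE rmorphD rmorphM.
have I_segment t : 0 <= t <= 1 -> I (a + t * c).
  move=> /(I_invex _ _ _ aI bI)[x Ix]; rewrite pointE => /complexI <-.
  exact: Ix.
apply: fractional_trapezoid_bound => //.
- move=> x /andP[ax xac]; apply: f_diff.
  rewrite (_ : x = a + (x - a) / c * c); last by rewrite divfK ?gt_eqF// addrC subrK.
  apply: I_segment; rewrite ler_pdivlMr// ler_pdivrMr// mul0r mul1r subr_ge0 ax.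
  by rewrite lerBlDl.
- by move=> t t01; apply: h_ge0; apply: J_01; rewrite /= in_itv.
- move=> t t01; apply: f'_preinvex aI bI t01 (I_segment _ t01) _.
  by rewrite pointE.
Qed.
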